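(* For every integer $k\geq 2$ there exists a finite, simple, connected graph of diameter $3$ and order $k+3^k$ which has metric dimension $k$ and exactly one metric basis.
   Context: For vertices $u,v$ of a connected graph $G$, $d(u,v)$ is the distance between them. For an ordered set $W=\{w_1,\dots,w_k\}\subseteq V(G)$ and $v\in V(G)$, $r(v|W)=(d(v,w_1),\dots,d(v,w_k))$. $W$ is a resolving set if distinct vertices have distinct representations $r(\cdot|W)$. A resolving set of minimum cardinality is a metric basis; its cardinality is the metric dimension $\beta(G)$. *)

(* Defs.v *)
From HB Require Import structures.
From mathcomp Require Import all_boot.

Set Implicit Arguments.
Unset Strict Implicit.
Unset Printing Implicit Defensive.

Record sgraph (V : finType) := SGraph {
  adj :> rel V;
  adj_sym : symmetric adj;
  adj_irr : irreflexive adj }.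

Section Metric.

Variables (V : finType) (G : sgraph V).
Implicit Types (u v : V) (n : nat) (W : {set V}).

(* [path] over an edge relation allows repeated vertices. *)
Definition has_walk u v n : bool :=
  [exists p : n.-tuple V, path G u p && (last u p == v)].

(* The least length of a walk from [u] to [v]; lengths below [#|V|] suffice.
   The junk value [#|V|] is taken when there is no walk. *)
Definition dist u v : nat := find (has_walk u v) (iota 0 #|V|).

Definition connected_graph : Prop := forall u v, connect G u v.

Definition diameter : nat := \max_u \max_v dist u v.

Definition metric_repr (ws : seq V) v : seq nat := [seq dist v w | w <- ws].

(* Whether [ws] resolves [V] depends only on its set of entries, so a set is
   listed in the order given by [enum]. *)
Definition resolving W : bool := injectiveb (metric_repr (enum W)).

Definition metric_basis W : bool :=
  resolving W && [forall W' : {set V}, resolving W' ==> (#|W| <= #|W'|)].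

(* The default [setT] is always resolving (see [resolvingT]). *)
Definition metric_dim : nat := #|[arg min_(W < setT | resolving W) #|W| ]|.

Lemma dist_connect u v : connect G u v ->
  has_walk u v (dist u v) /\ (forall n, has_walk u v n -> dist u v <= n).
Proof.
case/connectP=> p0 p0P ->; case/shortenP: p0P => p pP Up _.
have lt_pV : size p < #|V| by have := card_uniqP Up => /= <-; exact: max_card.
have pW : has_walk u (last u p) (size p).
  by apply/existsP; exists (in_tuple p); rewrite pP eqxx.
have hasW : has (has_walk u (last u p)) (iota 0 #|V|).
  by apply/hasP; exists (size p); rewrite // mem_iota.
have lt_d : dist u (last u p) < #|V| by rewrite -[#|V|](size_iota 0) -has_find.
split=> [|n nW]; first by have := nth_find 0 hasW; rewrite nth_iota.
rewrite leqNgt; apply/negP=> lt_n; have := before_find 0 lt_n.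
by rewrite nth_iota ?nW // (ltn_trans lt_n).
Qed.

Lemma dist_eq0 u v : (dist u v == 0) = (u == v).
Proof.
rewrite /dist; case E: #|V| => [|n]; first by have := fintype0 u E.
rewrite /=; have -> : has_walk u v 0 = (u == v).
  apply/existsP/idP => [[p]|/eqP->]; last by exists [tuple]; rewrite /= eqxx.
  by rewrite tuple0.
by case: (u == v).
Qed.

Lemma resolvingT : resolving setT.
Proof.
apply/injectiveP=> u v /eq_in_map /(_ u); rewrite mem_enum inE => /(_ isT) E.
by apply/eqP; rewrite eq_sym -dist_eq0 -E dist_eq0.
Qed.

Lemma metric_basis_card W : metric_basis W = resolving W && (#|W| == metric_dim).
Proof.
rewrite /metric_basis /metric_dim; case: arg_minnP => [|W0 rW0 minW0].
  exact: resolvingT.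
case rW: (resolving W) => //=; apply/forallP/eqP => [H|-> W'].
  by apply/eqP; rewrite eqn_leq minW0 // andbT; have := H W0; rewrite rW0.
by apply/implyP=> /minW0.
Qed.

End Metric.

(* Main.v *)
Require Import Defs.
From HB Require Import structures.
From mathcomp Require Import all_boot.

(** Take k landmarks together with all labels f : 'I_k -> 'I_3; join the
   landmark i to the labels f with f i = 0, and join two distinct labels when
   they differ by at most 1 in every coordinate. Then the distance from f to
   the landmark i is f i + 1, so the landmarks resolve the graph. On the other
   hand the constant label 1 is within distance 1 of every label, so two labels
   are at distance at most 2. Hence if a resolving set S with at most k elements
   contains a label, then the at least 3^k - k labels outside S have at most
   2 * 3^(k-1) representations, which is too few; and if S consists of
   landmarks only, then 3^k <= 3^|S| forces S to contain all of them. *)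

(** * Distance bounds in an arbitrary graph *)

Section Distance.

Variables (V : finType) (G : sgraph V).

Lemma dist_walk u p : path G u p -> dist G u (last u p) <= size p.
Proof.
move=> pP; have uv : connect G u (last u p) by apply/connectP; exists p.
case: (dist_connect uv) => _; apply.
by apply/existsP; exists (in_tuple p); rewrite pP eqxx.
Qed.

Lemma dist_triangle v u w : connect G u v -> connect G v w ->
  dist G u w <= dist G u v + dist G v w.
Proof.
move=> /dist_connect[/existsP[p /andP[pP /eqP pv]] _].
move=> /dist_connect[/existsP[q /andP[qP /eqP qw]] _].
have := @dist_walk u (p ++ q); rewrite cat_path last_cat pv pP qP qw.
by rewrite size_cat !size_tuple; apply.
Qed.

Lemma dist_adj u v : G u v -> dist G u v <= 1.
Proof. by move=> uv; apply: (@dist_walk u [:: v]); rewrite /= uv. Qed.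

(** A potential that drops by at most one along each edge certifies a lower bound on distance. *)
Lemma dist_lipschitz (phi : V -> nat) u v :
  (forall x y, G x y -> phi x <= (phi y).+1) -> connect G u v ->
  phi u <= phi v + dist G u v.
Proof.
move=> phiL /dist_connect[/existsP[p /andP[pP /eqP pv]] _].
rewrite -(size_tuple p); move: (tval p) pP pv => {}p + <-.
elim: p u => [|x p IHp] u /=; first by rewrite addn0.
case/andP=> ux /IHp le_x; apply: leq_trans (phiL _ _ ux) _.
by rewrite addnS ltnS.
Qed.

End Distance.

(** * The label graph and its distances *)

Section LabelGraph.

Variable k : nat.

Notation label := {ffun 'I_k -> 'I_3}.
Notation vertex := ('I_k + label)%type.

Implicit Types (i j : 'I_k) (f g : label) (u v w : vertex) (S : {set vertex}).

(** Equality or adjacency in the strong product of [k] three-vertex paths. *)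
Definition close f g :=
  [forall i, (f i <= (g i).+1) && (g i <= (f i).+1)].

Definition label_rel : rel vertex := fun u v =>
  match u, v with
  | inl _, inl _ => false
  | inl i, inr f | inr f, inl i => f i == ord0
  | inr f, inr g => (f != g) && close f g
  end.

Lemma label_rel_sym : symmetric label_rel.
Proof.
move=> [i|f] [j|g] //=; rewrite eq_sym; congr andb.
by apply: eq_forallb => i; rewrite andbC.
Qed.

Lemma label_rel_irr : irreflexive label_rel.
Proof. by move=> [i|f] //=; rewrite eqxx. Qed.

Definition label_graph := SGraph label_rel_sym label_rel_irr.
Local Notation G := label_graph.

Definition landmarks : {set vertex} := [set inl i | i : 'I_k].

Definition const_label (a : 'I_3) : label := [ffun=> a].
Definition center := const_label (@Ordinal 3 1 isT).

Lemma close_centerr f : close f center.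
Proof. by apply/forallP=> i; rewrite ffunE /=; case: (f i) => [[|[|[]]]]. Qed.

Lemma close_centerl f : close center f.
Proof. by apply/forallP=> i; rewrite ffunE /=; case: (f i) => [[|[|[]]]]. Qed.

Lemma connect_close f g : close f g -> connect G (inr f) (inr g).
Proof.
by move=> fg; have [->|nfg] := eqVneq f g; last apply/connect1/andP.
Qed.

Lemma dist_close f g : close f g -> dist G (inr f) (inr g) <= 1.
Proof.
move=> fg; have [->|nfg] := eqVneq f g; last by apply/dist_adj/andP.
by have := dist_eq0 G (inr g) (inr g); rewrite eqxx => /eqP->.
Qed.

Lemma connected_label_graph : connected_graph G.
Proof.
have uc u : connect G u (inr center).
  case: u => [i|f]; last exact/connect_close/close_centerr.
  (* The all-zero label is adjacent to every landmark. *)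
  apply: (@connect_trans _ _ (inr (const_label ord0))).
    by apply: connect1; rewrite /= ffunE.
  exact/connect_close/close_centerr.
move=> u v; apply: connect_trans (uc u) _.
by rewrite (sym_connect_sym label_rel_sym).
Qed.

Lemma dist_label_label f g : dist G (inr f) (inr g) <= 2.
Proof.
apply: leq_trans (@dist_triangle _ G (inr center) _ _ _ _) _;
  try exact: connected_label_graph.
by apply: (@leq_add _ _ 1 1); apply: dist_close;
  rewrite ?close_centerr ?close_centerl.
Qed.

Lemma dist_landmark_label i g : dist G (inl i) (inr g) <= 3.
Proof.
apply: leq_trans (@dist_triangle _ G (inr (const_label ord0)) _ _ _ _) _;
  try exact: connected_label_graph.
apply: (@leq_add _ _ 1 2); last exact: dist_label_label.
by apply: dist_adj; rewrite /= ffunE.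
Qed.

Lemma dist_landmark_landmark i j : dist G (inl i) (inl j) <= 2.
Proof.
apply: (@dist_walk _ G (inl i) [:: inr (const_label ord0); inl j]).
by rewrite /= !ffunE.
Qed.

Lemma dist_label_landmark f i : dist G (inr f) (inl i) = (f i).+1.
Proof.
apply/eqP; rewrite eqn_leq; apply/andP; split.
  (* Upper bound: lower coordinate [i] one unit per edge until it is 0, where the landmark is
     adjacent. *)
  have [n] := ubnP (f i); elim: n => // n IHn in f *; rewrite ltnS => le_fi_n.
  have [fi0|fi_gt0] := posnP (f i).
    by rewrite fi0; apply: dist_adj; apply/eqP/val_inj.
  have lt_p : (f i).-1 < 3 by apply: leq_ltn_trans (leq_pred _) (ltn_ord _).
  pose g : label := [ffun j => if j == i then Ordinal lt_p else f j].
  have gi : val (g i) = (f i).-1 by rewrite ffunE eqxx.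
  apply: leq_trans (@dist_triangle _ G (inr g) _ _ _ _) _;
    try exact: connected_label_graph.
  rewrite -[leqRHS]add1n; apply: leq_add.
    apply/dist_close/forallP=> j; rewrite ffunE; case: eqP => [->|_] /=.
      by rewrite prednK // leqnn (leq_trans (leq_pred _)).
    by rewrite leqnSn.
  have /IHn : g i < n by rewrite gi prednK.
  by rewrite gi prednK.
(* Lower bound: labels take values 1, 2, 3, and 2 is the only value within one of all of them, hence
   the choice at the other landmarks. *)
pose phi u := match u with
  | inl j => if j == i then 0 else 2
  | inr g => (g i).+1
  end.
have := @dist_lipschitz _ G phi (inr f) (inl i) _ (connected_label_graph _ _).
rewrite /= eqxx; apply=> -[j|g] [j'|h] //=.
- by case: ifP.
- by move/eqP=> gj; case: eqP => [<-|_]; [rewrite gj|exact: ltn_ord].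
- by case/andP=> _ /forallP/(_ i)/andP[].
Qed.

(** * Resolving sets and the counting bound *)

Lemma resolving_landmarks : resolving G landmarks.
Proof.
apply/injectiveP=> u v /eq_in_map E.
have {}E i : dist G u (inl i) = dist G v (inl i).
  by apply: E; rewrite mem_enum imset_f.
(* If either vertex is a landmark, the zero in its representation identifies the other; two labels
   are compared coordinatewise. *)
case: u v E => [i|f] [j|g] E.
- by apply/eqP; rewrite eq_sym -(dist_eq0 G) -E dist_eq0.
- by apply/eqP; rewrite eq_sym -(dist_eq0 G) -E dist_eq0.
- by apply/eqP; rewrite -(dist_eq0 G) E dist_eq0.
- congr inr; apply/ffunP=> i; apply: val_inj.
  by have := E i; rewrite !dist_label_landmark => -[].
Qed.

Definition is_landmark w : bool := if w is inl _ then true else false.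

(** The first term bounds the labels in [S]. A label outside [S] is determined by its distances to
    [S], which lie in 1..3 at a landmark and in 1..2 at a label. *)
Lemma resolving_label_bound S : resolving G S ->
  3 ^ k <= #|S :\: landmarks| + \prod_(w in S) (if is_landmark w then 3 else 2).
Proof.
move=> /injectiveP rS.
pose A := [set f : label | inr f \notin S].
pose F w : pred 'I_3 := [pred x : 'I_3 | is_landmark w || (x < 2)].
(* Distances from outside [S] are positive, so the shift by one loses nothing; the default [ord0]
   off [S] places [r f] in a [pfamily], whose cardinality is a product. *)
pose r f : {ffun vertex -> 'I_3} :=
  [ffun w => if w \in S then inord (dist G (inr f) w).-1 else ord0].
have dist_gt0 f w : f \in A -> w \in S -> 0 < dist G (inr f) w.
  rewrite inE => fS wS; rewrite lt0n dist_eq0.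
  by apply: contraNneq fS => ->.
have dist_lt f w : (dist G (inr f) w).-1 < (if is_landmark w then 3 else 2).
  case: w => [i|g] /=; first by rewrite dist_label_landmark ltn_ord.
  by have := dist_label_label f g; case: (dist _ _ _).
have dist_lt3 f w : (dist G (inr f) w).-1 < 3.
  by apply: leq_trans (dist_lt f w) _; case: ifP.
have r_inj : {in A &, injective r}.
  move=> f g fA gA /ffunP E; suff: inr f = inr g :> vertex by case.
  apply/rS/eq_in_map=> w; rewrite mem_enum => wS.
  have := E w; rewrite !ffunE wS => /(congr1 val) /=.
  rewrite !inordK // => {}E.
  by rewrite -(prednK (dist_gt0 f w fA wS)) E prednK // dist_gt0.
have r_fam : r @: A \subset pfamily ord0 S F.
  apply/subsetP=> _ /imsetP[f _ ->]; apply/pfamilyP; split=> [|w wS].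
    by apply/supportP=> w /negPf wS; rewrite ffunE wS.
  rewrite ffunE wS inE /=; have := dist_lt f w.
  by case: (is_landmark w) => //= lt2; rewrite inordK.
have cardF w : #|F w| = if is_landmark w then 3 else 2.
  rewrite -sum1_card big_mkcond !big_ord_recl big_ord0 !inE /=.
  by case: (is_landmark w).
have := subset_leq_card r_fam; rewrite card_in_imset // card_pfamily.
rewrite foldrE big_image /= (eq_bigr _ (fun w _ => cardF w)) => leA.
(* The complement of [A] consists of the labels in [S]. *)
have := cardsC A; rewrite card_ffun !card_ord => <-; rewrite addnC leq_add //.
rewrite -(@card_imset _ vertex inr); last by move=> ? ? [].
apply/subset_leq_card/subsetP=> _ /imsetP[f + ->].
rewrite !inE negbK => ->; rewrite andbT.
by apply/imsetP=> -[].
Qed.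

Lemma card_landmarks : #|landmarks| = k.
Proof. by rewrite card_imset ?card_ord // => i j []. Qed.

(** Leaves room for the at most [k] labels inside a small resolving set; the induction starts from 2
    < 3. *)
Lemma ltn_expn3_pred : 1 < k -> k < 3 ^ k.-1.
Proof.
case: k => [|[|n]] // _; rewrite /=.
elim: n => // n IHn; rewrite expnS.
by apply: leq_ltn_trans IHn _; rewrite ltn_Pmull // expn_gt0.
Qed.

Lemma resolving_small S : 1 < k -> resolving G S -> #|S| <= k -> S = landmarks.
Proof.
move=> k_gt1 /resolving_label_bound leS leSk.
have [sSL|/subsetPn[w wS wL]] := boolP (S \subset landmarks).
  apply/eqP; rewrite eqEcard sSL card_landmarks -(@leq_exp2l 3) //.
  apply: leq_trans leS _; move: sSL; rewrite -setD_eq0 => /eqP->.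
  by rewrite cards0 -prod_nat_const; apply: leq_prod => w _; case: ifP.
suff: 3 ^ k < 3 ^ k by rewrite ltnn.
have wU : is_landmark w = false by case: w wL {wS} => // i; rewrite imset_f.
apply: leq_ltn_trans leS _.
(* The label [w] contributes a factor 2; the at most [k - 1] other factors are at most 3. *)
rewrite (big_setD1 w wS) /= wU.
have le_prod : \prod_(v in S :\ w) (if is_landmark v then 3 else 2) <= 3 ^ k.-1.
  apply: (@leq_trans (3 ^ #|S :\ w|)).
    by rewrite -prod_nat_const; apply: leq_prod => v _; case: ifP.
  rewrite leq_exp2l // -ltnS prednK ?(ltnW k_gt1) //.
  by move: leSk; rewrite (cardsD1 w) wS.
(* Split [3 ^ k] as [3 ^ k.-1 + 2 * 3 ^ k.-1] and compare termwise, strictly in the first term. *)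
rewrite -[X in _ < 3 ^ X](prednK (ltnW k_gt1)) expnS -[3]/(1 + 2) mulnDl mul1n.
rewrite -addSn leq_add // ?leq_mul2l //.
apply: leq_trans (ltn_expn3_pred k_gt1); rewrite ltnS.
exact: leq_trans (subset_leq_card (subsetDl _ _)) leSk.
Qed.

(** * Diameter and the unique basis *)

Lemma diameter_label_graph : 0 < k -> diameter G = 3.
Proof.
move=> k_gt0; apply/eqP; rewrite eqn_leq; apply/andP; split.
  apply/bigmax_leqP=> -[i|f] _; apply/bigmax_leqP=> -[j|g] _.
  - exact: leqW (dist_landmark_landmark i j).
  - exact: dist_landmark_label.
  - by rewrite dist_label_landmark.
  - exact: leqW (dist_label_label f g).
(* The constant label 2 is at distance 3 from every landmark. *)
pose f := const_label ord_max.
apply: leq_trans (leq_bigmax (inr f : vertex)).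
apply: leq_trans (leq_bigmax (inl (Ordinal k_gt0) : vertex)).
by rewrite dist_label_landmark ffunE.
Qed.

Lemma metric_basis_landmarks : 1 < k -> metric_basis G landmarks.
Proof.
move=> k_gt1; rewrite /metric_basis resolving_landmarks /=.
apply/forallP=> S; apply/implyP=> rS; rewrite leqNgt card_landmarks.
apply/negP=> ltS; have := resolving_small S k_gt1 rS (ltnW ltS).
by move=> eqS; rewrite eqS card_landmarks ltnn in ltS.
Qed.

End LabelGraph.

Theorem theorem5 (k : nat) (hk : 2 <= k) :
  exists (V : finType) (G : sgraph V),
    [/\ connected_graph G,
        diameter G = 3,
        #|V| = k + 3 ^ k,
        metric_dim G = k
      & exists! W : {set V}, metric_basis G W].
Proof.
have bL := metric_basis_landmarks k hk.
have dim : metric_dim (label_graph k) = k.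
  by move: bL; rewrite metric_basis_card card_landmarks => /andP[_ /eqP].
exists ('I_k + {ffun 'I_k -> 'I_3})%type, (label_graph k); split=> //.
- exact: connected_label_graph.
- exact/diameter_label_graph/ltnW.
- by rewrite card_sum card_ffun !card_ord.
- exists (landmarks k); split=> // S.
  rewrite metric_basis_card dim => /andP[rS /eqP cS].
  by rewrite (resolving_small k S hk rS) ?cS.
Qed.
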